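(* Let $m,n\ge 2$, let $1\le p\le\infty$, and put $d:=\min\{m,n\}$. For all $A_1,\dots,A_m\in\mathbb{M}_n$, $$\Bigl\|\sum_{k=1}^m A_k\Bigr\|_p\ \le\ d^{\frac12-\frac{1}{2p}}\;\Bigl\|\sum_{k=1}^m |A_k|\Bigr\|_p.$$
   Context: $\mathbb{M}_n$ is the set of $n\times n$ complex matrices, $Z^*$ is the conjugate transpose of $Z$, and $|Z|:=(Z^*Z)^{1/2}$. For $1\le p<\infty$, the Schatten $p$-norm is $\|X\|_p:=(\operatorname{Tr}|X|^p)^{1/p}$; $\|X\|_\infty$ is the operator norm (largest singular value), and $\frac1\infty=0$. *)

(* Defs.v *)
From HB Require Import structures.
From mathcomp Require Import all_boot all_order all_algebra.
From mathcomp Require Import sesquilinear spectral.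
From mathcomp Require Import complex.
From mathcomp Require Import all_classical all_reals all_analysis.
Set Implicit Arguments.
Unset Strict Implicit.
Unset Printing Implicit Defensive.
Import Order.TTheory GRing.Theory Num.Theory.
Local Open Scope ring_scope.
Local Open Scope sesquilinear_scope.

Section Schatten.
Context {R : realType} {n : nat}.
Implicit Types A X Z : 'M[R[i]]_n.

(* Real power of a positive semidefinite matrix, by functional calculus on a
   spectral decomposition A = P^-1 *m diag_mx D *m P with P unitary. The
   spectral value is a nonnegative real when A is positive semidefinite, so
   complex.Re only changes its type; the result has no meaning for other A. *)
Definition psdpow A (r : R) : 'M[R[i]]_n :=
  invmx (spectralmx A)
    *m diag_mx (map_mx (fun z => (complex.Re z `^ r)%:C%C) (spectral_diag A))
    *m spectralmx A.

Definition absmx Z : 'M[R[i]]_n := psdpow (Z ^t* *m Z) 2^-1.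

Lemma spectral_diag_gram_ge0 Z i : 0 <= spectral_diag (Z ^t* *m Z) 0 i.
Proof.
set A := _ *m _; set P := spectralmx A.
have AN : A \is normalmx.
  by apply/normalmxP; rewrite /A trmx_mul map_mxM trmxCK.
have Aeq := elimT (@orthomx_spectralP _ _ _) AN.
have : diag_mx (spectral_diag A) = (Z *m P^t*)^t* *m (Z *m P^t*).
  rewrite trmx_mul map_mxM trmxCK mulmxA -(mulmxA P) -/A {2}Aeq.
  by rewrite -invmx_unitary ?spectral_unitarymx// !mulmxA mulmxV ?spectral_unit//
    mul1mx mulmxK ?spectral_unit.
move=> /matrixP/(_ i i); rewrite !mxE eqxx mulr1n => ->.
by apply: sumr_ge0 => k _; rewrite !mxE mulrC mul_conjC_ge0.
Qed.

(* With absmx_psd: absmx Z is the positive semidefinite square root of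
   Z ^t* *m Z. *)
Lemma absmx_sqr Z : absmx Z *m absmx Z = Z ^t* *m Z.
Proof.
have := spectral_diag_gram_ge0 Z; rewrite /absmx /psdpow.
set A := _ *m _ => s0; have AN : A \is normalmx.
  by apply/normalmxP; rewrite /A trmx_mul map_mxM trmxCK.
rewrite [in RHS](elimT (@orthomx_spectralP _ _ _) AN).
rewrite !mulmxA mulmxK ?spectral_unit// -!mulmxA; congr (_ *m _).
rewrite !mulmxA; congr (_ *m _); rewrite mulmx_diag; congr diag_mx.
apply/rowP => i; rewrite !mxE -rmorphM/=.
have r0 := s0 i; have ReE := RRe_real (ger0_real r0).
have rr : 0 <= complex.Re (spectral_diag A 0 i) by rewrite -ler0c ReE.
rewrite !powR12_sqrt// -expr2 sqr_sqrtr// ReE.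
Qed.

Lemma absmx_psd Z (v : 'rV[R[i]]_n) : 0 <= (v *m absmx Z *m v^t*) 0 0.
Proof.
rewrite /absmx /psdpow invmx_unitary ?spectral_unitarymx//.
set P := spectralmx _; set d := map_mx _ (spectral_diag _).
have -> : v *m (P^t* *m diag_mx d *m P) *m v^t* =
    (v *m P^t*) *m diag_mx d *m (v *m P^t*)^t*.
  by rewrite trmx_mul map_mxM trmxCK !mulmxA.
rewrite mul_mx_diag !mxE sumr_ge0// => i _.
rewrite !mxE mulrAC mulr_ge0 ?mul_conjC_ge0//.
by rewrite ler0c powR_ge0.
Qed.

(* The singular values of Z, listed with multiplicity in no particular order:
   the eigenvalues of absmx Z. *)
Definition singular_value Z (i : 'I_n) : R :=
  complex.Re (spectral_diag (absmx Z) 0 i).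

(* Only meant for 1 <= p; the value at -oo is junk. The trace is a nonnegative
   real number, and singular values are nonnegative, so 0 is neutral for max. *)
Definition schatten_norm (p : \bar R) X : R :=
  match p with
  | r%:E => complex.Re (\tr (psdpow (absmx X) r)) `^ r^-1
  | +oo%E => \big[Num.max/0]_(i < n) singular_value X i
  | -oo%E => 0
  end.

End Schatten.

(* Main.v *)
Require Import Defs.
From mathcomp Require Import all_boot all_order all_algebra.
From mathcomp Require Import sesquilinear spectral.
From mathcomp Require Import complex.
From mathcomp Require Import all_classical all_reals all_analysis.
From mathcomp Require Import ring lra.
Set Implicit Arguments.
Unset Strict Implicit.
Unset Printing Implicit Defensive.
Import Order.TTheory GRing.Theory Num.Theory.
Local Open Scope ring_scope.

(** Write X for the sum of the A_k, S for the sum of the |A_k|, x_i and s_l for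
their singular values, and take singular value decompositions
X = W diag(x) V and A_k = Y_k diag(d_k) P_k, so that
|A_k| = P_k^* diag(d_k) P_k. Put C_k = W^* Y_k and B_k = P_k V^*.  Reading
W^* X V^* on the diagonal gives
  x_i = \sum_(k, j) C_k(i, j) d_k(j) B_k(j, i),
and the Cauchy-Schwarz inequality with weights d_k(j) bounds x_i^2 by a_i b_i,
where
  a_i = \sum_(k, j) d_k(j) |B_k(j, i)|^2,
  b_i = \sum_(k, j) d_k(j) |C_k(i, j)|^2.

Both a and b are images of s under nonnegative matrices G and H with column
sums at most 1. The number a_i is a diagonal entry of V S V^*, which gives for
G a matrix with row sums at most 1. For b one first writes the d_k(j) as the
image of s under a doubly substochastic matrix q, which is a pinching argument
(lemma [pinching]); then H is the product of (|C_k(i, j)|^2) by q. Each C_k is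
a contraction, so the row sums of H are at most m; they are also at most n,
because H has n columns and each entry is bounded by a column sum.

It remains to pass to l_p norms. Since the norms of a matrix and of its vector
of singular values agree, the Schur test [lp_schur] yields
|a|_p <= |s|_p and |b|_p <= d^(1 - 1/p) |s|_p with d = min(m, n), and
[lp_geomean] yields |x|_p^2 <= |a|_p |b|_p.  Taking the square root produces
the constant d^(1/2 - 1/(2p)). *)

(** * The l_p norm on finite families of nonnegative reals *)

Section Lp.
Context {R : realType}.
Implicit Types I L : finType.

(** Convexity of the power function, in the form needed for a Jensen inequality
whose weights do not sum to 1: the graph lies above its tangent at b. This is
Young's inequality for x and b^(p-1). *)
Lemma powR_tangent (p x b : R) : 1 <= p -> 0 <= x -> 0 <= b ->
  p * (x * b `^ (p - 1)) - (p - 1) * b `^ p <= x `^ p.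
Proof.
move=> p1 x0 b0; have p0 : 0 < p by lra.
have [->|pn1] := eqVneq p 1.
  by rewrite subrr powRr0 mul0r subr0 mul1r mulr1 powRr1.
have p10 : 0 < p - 1 by rewrite subr_gt0 lt_neqAle eq_sym pn1.
have q0 : 0 < p / (p - 1) by rewrite divr_gt0.
have pn0 : p != 0 by rewrite gt_eqF.
have pn10 : p - 1 != 0 by rewrite gt_eqF.
have := conjugate_powR x0 (powR_ge0 b (p - 1)) p0 q0.
have -> : p^-1 + (p / (p - 1))^-1 = 1 by field; rewrite ?pn0 ?pn10.
move=> /(_ erefl); rewrite -powRrM.
have -> : (p - 1) * (p / (p - 1)) = p by field.
move=> H; have := ler_wpM2l (ltW p0) H.
have -> : p * (x `^ p / p + b `^ p / (p / (p - 1))) = x `^ p + (p - 1) * b `^ p.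
  by field; rewrite pn0 pn10.
lra.
Qed.

(** The value of [lp] at an extended real outside [1, +oo] carries no meaning;
the neutral element 0 of the maximum is right for nonnegative families. *)
Definition lp (p : \bar R) I (x : I -> R) : R :=
  match p with
  | r%:E => (\sum_i x i `^ r) `^ r^-1
  | +oo%E => \big[Num.max/0]_i x i
  | -oo%E => 0
  end.

Lemma lp_ge0 p I (x : I -> R) : 0 <= lp p x.
Proof.
case: p => [r| |] //=; first exact: powR_ge0.
by elim/big_rec: _ => // i y _ y0; rewrite le_max y0 orbT.
Qed.

Lemma le_lp_pinfty I (x : I -> R) i : x i <= lp +oo%E x.
Proof. exact: le_bigmax. Qed.

Lemma lp_pinfty_le I (x : I -> R) c : 0 <= c -> (forall i, x i <= c) ->
  lp +oo%E x <= c.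
Proof. by move=> c0 xc; apply/bigmax_le. Qed.

(** Schur test: a nonnegative matrix with column sums at most 1 and row sums at
most r has norm at most 1 on l_1 and at most r on l_oo, and the bound
interpolates between the two. For finite p the tangent inequality at the point
x_i / r replaces the interpolation theorem. *)
Lemma lp_schur (p : \bar R) r I L (q : I -> L -> R) (x : I -> R) (y : L -> R) :
  (1 <= p)%E -> 0 < r ->
  (forall i l, 0 <= q i l) -> (forall l, 0 <= y l) ->
  (forall i, \sum_l q i l <= r) -> (forall l, \sum_i q i l <= 1) ->
  (forall i, x i = \sum_l q i l * y l) ->
  lp p x <= r `^ (1 - fine p^-1%E) * lp p y.
Proof.
move=> p1 r0 q0 y0 qr qc xE.
have x0 i : 0 <= x i by rewrite xE sumr_ge0// => l _; rewrite mulr_ge0.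
case: p p1 => [p| |] //; rewrite ?lee_fin => p1; last first.
  rewrite invey (_ : fine 0%E = 0)// subr0 powRr1 ?(ltW r0)//.
  apply: lp_pinfty_le => [|i]; first by rewrite mulr_ge0 ?lp_ge0 ?(ltW r0).
  rewrite xE; apply: (@le_trans _ _ (\sum_l q i l * lp +oo%E y)).
    by apply: ler_sum => l _; rewrite ler_wpM2l// le_lp_pinfty.
  by rewrite -mulr_suml ler_wpM2r// lp_ge0.
have p0 : 0 < p by lra.
rewrite inver gt_eqF//= .
have key : \sum_i x i `^ p <= r `^ (p - 1) * \sum_l y l `^ p.
  have pw i : x i `^ p <= r `^ (p - 1) * \sum_l q i l * y l `^ p.
    set b := x i / r.
    have b0 : 0 <= b by rewrite divr_ge0// (ltW r0).
    have xb : x i = r * b by rewrite /b mulrC divfK ?gt_eqF.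
    rewrite {1}xb powRM ?(ltW r0)//.
    have -> : r `^ p = r `^ (p - 1) * r by rewrite mulrC mulr_powRB1// (ltW r0).
    rewrite -mulrA ler_wpM2l ?powR_ge0//.
    apply: (@le_trans _ _ (\sum_l q i l *
        (p * (y l * b `^ (p - 1)) - (p - 1) * b `^ p))); last first.
      by apply: ler_sum => l _; rewrite ler_wpM2l// powR_tangent.
    have -> : \sum_l q i l * (p * (y l * b `^ (p - 1)) - (p - 1) * b `^ p)
        = p * b `^ (p - 1) * (x i) - (p - 1) * b `^ p * \sum_l q i l.
      rewrite xE !mulr_sumr -sumrB; apply: eq_bigr => l _; ring.
    rewrite xb.
    have -> : p * b `^ (p - 1) * (r * b) = p * r * (b `^ p).
      by rewrite -(mulr_powRB1 b0 p0); ring.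
    have c0 : 0 <= (p - 1) * b `^ p by rewrite mulr_ge0 ?powR_ge0// subr_ge0.
    have := ler_wpM2l c0 (qr i).
    lra.
  apply: (le_trans (ler_sum _ (fun i _ => pw i))).
  rewrite -mulr_sumr ler_wpM2l ?powR_ge0// exchange_big/=.
  apply: ler_sum => l _; rewrite -mulr_suml.
  by rewrite -[leRHS]mul1r ler_wpM2r ?powR_ge0.
have -> : r `^ (1 - p^-1) = (r `^ (p - 1)) `^ p^-1.
  by rewrite -powRrM; congr (_ `^ _); field; rewrite gt_eqF.
rewrite -powRM ?powR_ge0 ?sumr_ge0// => [|i _]; last exact: powR_ge0.
have nn I' (z : I' -> R) : \sum_i z i `^ p \is Num.nneg.
  by rewrite nnegrE sumr_ge0// => i _; exact: powR_ge0.
apply: ge0_ler_powR => //; first by rewrite invr_ge0 (ltW p0).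
by rewrite nnegrE mulr_ge0 ?powR_ge0// -nnegrE.
Qed.

(** Cauchy-Schwarz without square roots: the condition s^2 <= a b on nonnegative
triples is preserved by addition. *)
Lemma cauchy_schwarz_sum I (s a b : I -> R) :
  (forall i, 0 <= s i) -> (forall i, 0 <= a i) -> (forall i, 0 <= b i) ->
  (forall i, s i ^+ 2 <= a i * b i) ->
  (\sum_i s i) ^+ 2 <= (\sum_i a i) * \sum_i b i.
Proof.
move=> s0 a0 b0 sab.
pose K (s a b : R) := [/\ 0 <= s, 0 <= a, 0 <= b & s ^+ 2 <= a * b].
suff [] : K (\sum_i s i) (\sum_i a i) (\sum_i b i) by [].
apply: (big_ind3 K) => [|s1 a1 b1 x y z [? ? ? H1] [? ? ? H2]|i _]; split=> //.
- exact: addr_ge0.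
- exact: addr_ge0.
- exact: addr_ge0.
have H : 2 * (s1 * x) <= a1 * z + y * b1.
  rewrite -ler_sqr ?nnegrE; [|by rewrite !mulr_ge0|by rewrite addr_ge0 ?mulr_ge0].
  have : (s1 * x) ^+ 2 <= (a1 * b1) * (y * z).
    by rewrite exprMn ler_pM ?sqr_ge0.
  have := sqr_ge0 (a1 * z - y * b1).
  lra.
lra.
Qed.

Lemma powR_geomean (p s a b : R) : 0 <= p -> 0 <= s -> 0 <= a -> 0 <= b ->
  s ^+ 2 <= a * b -> (s `^ p) ^+ 2 <= a `^ p * b `^ p.
Proof.
move=> p0 s0 a0 b0; rewrite !expr2 -!powRM// => sab.
by apply: ge0_ler_powR; rewrite ?nnegrE ?mulr_ge0.
Qed.

Lemma lp_geomean (p : \bar R) I (s a b : I -> R) : (1 <= p)%E ->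
  (forall i, 0 <= s i) -> (forall i, 0 <= a i) -> (forall i, 0 <= b i) ->
  (forall i, s i ^+ 2 <= a i * b i) ->
  lp p s ^+ 2 <= lp p a * lp p b.
Proof.
move=> p1 s0 a0 b0 sab.
case: p p1 => [p p1|_|p1]; last by [].
  have {p1} p0 : 0 < p by rewrite lee_fin in p1; exact: lt_le_trans p1.
  have nn I' (z : I' -> R) : 0 <= \sum_i z i `^ p.
    by apply: sumr_ge0 => i _; exact: powR_ge0.
  have pV0 : 0 <= p^-1 by rewrite invr_ge0 ltW.
  apply: (powR_geomean pV0 (nn _ s) (nn _ a) (nn _ b)).
  apply: cauchy_schwarz_sum => i; rewrite ?powR_ge0//.
  exact: powR_geomean (ltW p0) _ _ _ (sab i).
have ab0 : 0 <= lp +oo%E a * lp +oo%E b by rewrite mulr_ge0 ?lp_ge0.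
rewrite -(sqr_sqrtr ab0) ler_sqr ?nnegrE ?lp_ge0 ?sqrtr_ge0//.
apply: lp_pinfty_le => [|i]; first exact: sqrtr_ge0.
rewrite -ler_sqr ?nnegrE ?sqrtr_ge0// sqr_sqrtr//; apply: le_trans (sab i) _.
by apply: ler_pM; rewrite ?le_lp_pinfty.
Qed.

End Lp.

(** * Partial isometries and Bessel's inequality *)

Section Gram.
Local Open Scope sesquilinear_scope.
Local Open Scope complex_scope.
Context {R : realType}.

(** The square of the modulus as an element of R, so that sums of squares can be
compared with the real singular values. *)
Definition sqmod (z : R[i]) : R := complex.Re z ^+ 2 + complex.Im z ^+ 2.

Lemma sqmodE z : (sqmod z)%:C = z * Num.conj z.
Proof. by rewrite /sqmod add_Re2_Im2 normCK. Qed.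

Lemma sqmod_ge0 z : 0 <= sqmod z.
Proof. by rewrite addr_ge0 ?sqr_ge0. Qed.

Lemma sqmodM z w : sqmod (z * w) = sqmod z * sqmod w.
Proof. by apply: complexI; rewrite rmorphM /= !sqmodE rmorphM; ring. Qed.

Lemma sqmodC z : sqmod (Num.conj z) = sqmod z.
Proof. by apply: complexI; rewrite !sqmodE conjCK mulrC. Qed.

Lemma sqmod_real (x : R) : sqmod x%:C = x ^+ 2.
Proof. by rewrite /sqmod /= expr0n addr0. Qed.

Lemma sqmod_eq0 z : sqmod z = 0 -> z = 0.
Proof.
by move=> /(congr1 (real_complex R)) /eqP; rewrite sqmodE mul_conjC_eq0 => /eqP.
Qed.

Lemma conjC_real (x : R) : Num.conj x%:C = x%:C.
Proof. by apply: conj_Creal; apply/complex_realP; exists x. Qed.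

Lemma adjM m n p (A : 'M[R[i]]_(m, n)) (B : 'M[R[i]]_(n, p)) :
  (A *m B) ^t* = B ^t* *m A ^t*.
Proof. by rewrite trmx_mul map_mxM. Qed.

Lemma adjB m n (A B : 'M[R[i]]_(m, n)) : (A - B) ^t* = A ^t* - B ^t*.
Proof. by apply/matrixP => i j; rewrite !mxE rmorphB. Qed.

Definition rdiag n (d : 'I_n -> R) : 'M[R[i]]_n := diag_mx (\row_j (d j)%:C).

Lemma mul_rdiag n (d e : 'I_n -> R) :
  rdiag d *m rdiag e = rdiag (fun j => d j * e j).
Proof.
rewrite /rdiag mulmx_diag; congr diag_mx.
by apply/rowP => i; rewrite !mxE rmorphM.
Qed.

Lemma rdiag_mulE n p (d : 'I_n -> R) (M : 'M[R[i]]_(n, p)) i j :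
  (rdiag d *m M) i j = (d i)%:C * M i j.
Proof. by rewrite mul_diag_mx !mxE. Qed.

Lemma mul_rdiagE n p (d : 'I_n -> R) (M : 'M[R[i]]_(p, n)) i j :
  (M *m rdiag d) i j = M i j * (d j)%:C.
Proof. by rewrite mul_mx_diag !mxE. Qed.

Lemma adj_rdiag n (d : 'I_n -> R) : (rdiag d) ^t* = rdiag d.
Proof.
apply/matrixP => i j; rewrite !mxE rmorphMn /= conjC_real eq_sym.
by have [->|] := eqVneq.
Qed.

Lemma rdiag1 n : rdiag (fun _ : 'I_n => 1) = 1%:M.
Proof. by apply/matrixP => i j; rewrite !mxE. Qed.

Lemma rdiag0 n : rdiag (fun _ : 'I_n => 0) = 0.
Proof. by apply/matrixP => i j; rewrite !mxE mul0rn. Qed.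

Lemma rdiagii n (d : 'I_n -> R) i : rdiag d i i = (d i)%:C.
Proof. by rewrite !mxE eqxx. Qed.

Lemma eq_rdiag n (d e : 'I_n -> R) : d =1 e -> rdiag d = rdiag e.
Proof. by move=> de; apply/matrixP => i j; rewrite !mxE de. Qed.

Lemma gram_rdiag n p (d : 'I_n -> R) (M : 'M[R[i]]_(n, p)) i :
  (M ^t* *m rdiag d *m M) i i = (\sum_j d j * sqmod (M j i))%:C.
Proof.
rewrite rmorph_sum mxE; apply: eq_bigr => j _.
rewrite mul_mx_diag !mxE rmorphM /= sqmodE; ring.
Qed.

Lemma gram n p (M : 'M[R[i]]_(n, p)) i :
  (M ^t* *m M) i i = (\sum_j sqmod (M j i))%:C.
Proof.
rewrite -[M^t*]mulmx1 -rdiag1 gram_rdiag.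
by congr _%:C; apply: eq_bigr => j _; rewrite mul1r.
Qed.

Lemma gram_eq0 n p (M : 'M[R[i]]_(n, p)) : M ^t* *m M = 0 -> M = 0.
Proof.
move=> M0; apply/matrixP => j i; rewrite mxE; apply: sqmod_eq0.
have : \sum_j sqmod (M j i) = 0 by apply: complexI; rewrite -gram M0 mxE.
move=> /eqP; rewrite psumr_eq0; last by move=> *; exact: sqmod_ge0.
by move=> /allP/(_ j (mem_index_enum _)) /= /eqP.
Qed.

(** A common property of unitary matrices and of the left factor of a singular
value decomposition, which may be rank-deficient. *)
Definition partial_isometry n p (W : 'M[R[i]]_(n, p)) := W *m W ^t* *m W = W.

Lemma partial_isometry_adj n p (W : 'M[R[i]]_(n, p)) :
  partial_isometry W -> partial_isometry (W ^t*).
Proof. by move=> WP; rewrite /partial_isometry -!adjM mulmxA WP. Qed.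

Lemma unitary_partial_isometry n (P : 'M[R[i]]_n) :
  P \is unitarymx -> partial_isometry P.
Proof.
by move=> /unitarymxP; rewrite /partial_isometry => ->; rewrite mul1mx.
Qed.

(** The matrix Q = W W^* is an orthogonal projection, so that the Gram matrix of
Y - Q Y, which is positive, equals Y^* Y - (W^* Y)^* (W^* Y). *)
Lemma bessel n p q (W : 'M[R[i]]_(n, p)) (Y : 'M[R[i]]_(n, q)) j :
  partial_isometry W ->
  \sum_i sqmod ((W ^t* *m Y) i j) <= \sum_i sqmod (Y i j).
Proof.
move=> WP; pose Z := Y - W *m W ^t* *m Y.
have : 0 <= (Z ^t* *m Z) j j.
  by rewrite gram ler0c sumr_ge0// => *; exact: sqmod_ge0.
have -> : Z ^t* *m Z = Y ^t* *m Y - (W ^t* *m Y) ^t* *m (W ^t* *m Y).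
  rewrite /Z; set Q := W *m W ^t*.
  have QE : Q ^t* = Q by rewrite adjM trmxCK.
  have QQ : Q *m Q = Q by rewrite mulmxA WP.
  rewrite adjB [(Q *m Y)^t*]adjM QE [(W^t* *m Y)^t*]adjM trmxCK.
  rewrite !mulmxA -[Y^t* *m W *m W^t*]mulmxA -/Q; clearbody Q.
  by rewrite mulmxBl !mulmxBr !mulmxA -(mulmxA _ Q Q) QQ subrr subr0.
by rewrite mxE [X in _ + X]mxE !gram -rmorphB ler0c subr_ge0.
Qed.

Lemma partial_isometry_col_le1 n p (W : 'M[R[i]]_(n, p)) j :
  partial_isometry W -> \sum_i sqmod (W i j) <= 1.
Proof.
move=> /partial_isometry_adj /(@bessel _ _ _ _ 1%:M j).
rewrite trmxCK mulmx1 => /le_trans; apply.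
rewrite (bigD1 j)//= big1 => [|i ij]; rewrite mxE.
  by rewrite eqxx addr0 (sqmod_real 1) expr1n.
by rewrite (negbTE ij) (sqmod_real 0) expr0n.
Qed.

(** The squared moduli of the entries of W^* Y form a doubly substochastic
matrix: this lemma and the next one are the only source of row and column bounds for
the matrices of squared overlaps below. *)
Lemma overlap_col_le1 n p q (W : 'M[R[i]]_(n, p)) (Y : 'M[R[i]]_(n, q)) j :
  partial_isometry W -> partial_isometry Y ->
  \sum_i sqmod ((W ^t* *m Y) i j) <= 1.
Proof.
by move=> WP YP; apply: le_trans (bessel Y j WP) (partial_isometry_col_le1 j YP).
Qed.

Lemma overlap_row_le1 n p q (W : 'M[R[i]]_(n, p)) (Y : 'M[R[i]]_(n, q)) i :
  partial_isometry W -> partial_isometry Y ->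
  \sum_j sqmod ((W ^t* *m Y) i j) <= 1.
Proof.
move=> WP YP; apply: le_trans (overlap_col_le1 i YP WP).
apply: ler_sum => j _.
by rewrite -sqmodC -[W^t* *m Y]trmxCK adjM trmxCK !mxE conjCK.
Qed.

End Gram.

(** * Positive semidefinite matrices and singular values *)

Section Spectral.
Local Open Scope sesquilinear_scope.
Local Open Scope complex_scope.
Context {R : realType}.

Definition psd n (S : 'M[R[i]]_n) :=
  S ^t* = S /\ forall v : 'rV[R[i]]_n, 0 <= (v *m S *m v^t*) 0 0.

Lemma psd_absmx n (Z : 'M[R[i]]_n) : psd (absmx Z).
Proof.
split; last exact: absmx_psd.
rewrite /absmx /psdpow invmx_unitary ?spectral_unitarymx// !adjM trmxCK mulmxA.
congr (_ *m _ *m _); rewrite (_ : map_mx _ _ = \row_j (complex.Re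
  (spectral_diag (Z ^t* *m Z) 0 j) `^ 2^-1)%:C) ?adj_rdiag//.
by apply/rowP => i; rewrite !mxE.
Qed.

Lemma psd_sum n (I : finType) (S : I -> 'M[R[i]]_n) :
  (forall i, psd (S i)) -> psd (\sum_i S i).
Proof.
move=> SP; apply: (big_ind (@psd n)) => //.
  split=> [|v]; first by apply/matrixP => i j; rewrite !mxE conjC0.
  by rewrite mulmx0 mul0mx mxE.
move=> A B [AE A0] [BE B0]; split=> [|v]; first by rewrite linearD map_mxD AE BE.
by rewrite mulmxDr mulmxDl mxE addr_ge0.
Qed.

Lemma psd_spectral n (S : 'M[R[i]]_n) : psd S ->
  exists P : 'M[R[i]]_n, let d j := complex.Re (spectral_diag S 0 j) in
  [/\ P \is unitarymx, forall j, 0 <= d j & S = P ^t* *m rdiag d *m P].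
Proof.
move=> [SE S0]; pose P := spectralmx S; exists P => d.
have PU : P \is unitarymx := spectral_unitarymx S.
have SN : S \is normalmx by apply/normalmxP; rewrite SE.
have := elimT (@orthomx_spectralP _ _ _) SN.
rewrite invmx_unitary// -/P => SP.
have D0 j : 0 <= spectral_diag S 0 j.
  have := S0 (row j P); rewrite -row_mul {1}SP !mulmxA (unitarymxP PU) mul1mx.
  have -> : (row j P)^t* = P^t* *m (delta_mx j 0 : 'cV_n).
    by rewrite -colE; apply/matrixP => a b; rewrite !mxE.
  rewrite mulmxA -row_mul -(mulmxA _ P) (unitarymxP PU) mulmx1 -colE.
  by rewrite !mxE eqxx.
have dE : S = P^t* *m rdiag d *m P.
  rewrite {1}SP; congr (_ *m diag_mx _ *m _); apply/rowP => j.
  by rewrite mxE RRe_real// ger0_real.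
by split=> // j; rewrite -ler0c RRe_real// ger0_real.
Qed.

Lemma unitary_conj_sqr n (P D : 'M[R[i]]_n) : P \is unitarymx ->
  (P ^t* *m D *m P) *m (P ^t* *m D *m P) = P ^t* *m (D *m D) *m P.
Proof.
by move=> /unitarymxP PK; rewrite !mulmxA -(mulmxA _ P) PK mulmx1.
Qed.

Lemma unitary_conj_cancel n (P D : 'M[R[i]]_n) : P \is unitarymx ->
  P *m (P ^t* *m D *m P) *m P ^t* = D.
Proof.
by move=> /unitarymxP PK; rewrite !mulmxA PK mul1mx -mulmxA PK mulmx1.
Qed.

(** Diagonalize S = P^* D P and T = Q^* E Q, and let V = P Q^*. From S^2 = T^2
one gets D^2 V = V E^2, that is, D_i^2 = E_j^2 wherever V_ij is nonzero; as D and
E are nonnegative, D V = V E. *)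
Lemma psd_sqrt_unique n (S T : 'M[R[i]]_n) :
  psd S -> psd T -> S *m S = T *m T -> S = T.
Proof.
move=> /psd_spectral[P [PU d0 SE]] /psd_spectral[Q [QU e0 TE]].
move: d0 e0 SE TE; set d := fun j => _; set e := fun j => _ => d0 e0 SE TE ST.
have PK := unitarymxP PU; have QK := unitarymxP QU.
have PK' : P^t* *m P = 1%:M by exact: mulmx1C.
have QK' : Q^t* *m Q = 1%:M by exact: mulmx1C.
pose V := P *m Q^t*.
have VE : rdiag d *m rdiag d *m V = V *m (rdiag e *m rdiag e).
  have : P *m (S *m S) *m Q^t* = P *m (T *m T) *m Q^t* by rewrite ST.
  rewrite {}SE {}TE !unitary_conj_sqr// /V.
  rewrite !mulmxA PK mul1mx -!(mulmxA P (Q^t*)) => ->.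
  by rewrite -!mulmxA QK mulmx1.
have VE1 : rdiag d *m V = V *m rdiag e.
  apply/matrixP => i j; move/matrixP/(_ i j): VE.
  rewrite !mul_rdiag !rdiag_mulE !mul_rdiagE.
  move: (V i j) => v /eqP; rewrite mulrC -subr_eq0 -mulrBr mulf_eq0.
  move=> /orP[/eqP ->|]; first by rewrite mulr0 mul0r.
  rewrite subr_eq0 => /eqP /complexI /eqP; rewrite -!expr2 eqrXn2 ?d0 ?e0//.
  by move=> /eqP ->; rewrite mulrC.
have := congr1 (fun M => P^t* *m M *m Q) VE1.
rewrite /V !mulmxA PK' mul1mx -TE.
by rewrite -!(mulmxA _ (Q^t*)) QK' mulmx1 -SE.
Qed.

(** The right-hand side of the theorem involves the singular values of the sum of
the |A_k|; this lemma turns them into the eigenvalues of that sum. *)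
Lemma absmx_id n (S : 'M[R[i]]_n) : psd S -> absmx S = S.
Proof.
move=> SP; apply: psd_sqrt_unique => //; first exact: psd_absmx.
by rewrite absmx_sqr; case: SP => ->.
Qed.

Lemma singular_value_ge0 n (Z : 'M[R[i]]_n) j : 0 <= singular_value Z j.
Proof. by have [P [_ d0 _]] := psd_spectral (psd_absmx Z); exact: d0. Qed.

(** With P diagonalizing |Z| and G = Z P^*, the columns of G are orthogonal and
their lengths are the singular values d_j, so W is obtained by normalizing
them. A zero column stays zero, since 0^-1 = 0, which makes W a partial
isometry instead of a unitary matrix. *)
Lemma svd n (Z : 'M[R[i]]_n) : exists W P : 'M[R[i]]_n,
  [/\ partial_isometry W, P \is unitarymx,
      W ^t* *m W *m rdiag (singular_value Z) = rdiag (singular_value Z),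
      Z = W *m rdiag (singular_value Z) *m P &
      absmx Z = P ^t* *m rdiag (singular_value Z) *m P].
Proof.
have [P /= [PU d0 ME]] := psd_spectral (psd_absmx Z).
rewrite -/(singular_value Z) in d0 ME *.
set d := singular_value Z in d0 ME *.
have PK := unitarymxP PU; have PK' : P^t* *m P = 1%:M by exact: mulmx1C.
pose G := Z *m P^t*.
have GG : G^t* *m G = rdiag (fun j => d j * d j).
  rewrite /G adjM trmxCK mulmxA -(mulmxA P) -absmx_sqr ME unitary_conj_sqr//.
  by apply: etrans (unitary_conj_cancel _ PU) _; rewrite mul_rdiag.
pose W := G *m rdiag (fun j => (d j)^-1).
have WW : W^t* *m W = rdiag (fun j => (d j)^-1 * (d j * d j * (d j)^-1)).
  by rewrite /W adjM adj_rdiag mulmxA -(mulmxA _ _ G) GG -mulmxA !mul_rdiag.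
(* The columns of G at which d vanishes are zero, because their lengths are. *)
have WD : W *m rdiag d = G.
  apply/eqP; rewrite -subr_eq0; apply/eqP/gram_eq0.
  have -> : W *m rdiag d - G = G *m rdiag (fun j => (d j)^-1 * d j - 1).
    rewrite /W -mulmxA mul_rdiag -[X in _ - X]mulmx1 -mulmxBr; congr (_ *m _).
    by apply/matrixP => i j; rewrite !mxE -mulrnBl rmorphB.
  rewrite adjM adj_rdiag mulmxA -(mulmxA _ _ G) GG !mul_rdiag -[RHS]rdiag0.
  apply: eq_rdiag => j; have [->|dj] := eqVneq (d j) 0; first by rewrite !(mulr0, mul0r).
  by rewrite mulVf// subrr mul0r mul0r.
exists W, P; split=> //.
- rewrite /partial_isometry -mulmxA WW /W -mulmxA mul_rdiag; congr (_ *m _).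
  apply: eq_rdiag => j; have [->|dj] := eqVneq (d j) 0; first by rewrite invr0 !mul0r.
  by field.
- rewrite WW mul_rdiag; apply: eq_rdiag => j.
  have [->|dj] := eqVneq (d j) 0; first by rewrite !mulr0.
  by field.
- by rewrite WD /G -mulmxA PK' mulmx1.
Qed.

Lemma schatten_normE n (p : \bar R) (X : 'M[R[i]]_n) :
  schatten_norm p X = lp p (singular_value X).
Proof.
case: p => [r| |] //=; congr (_ `^ _).
rewrite /psdpow mxtrace_mulC mulmxA mulmxV ?spectral_unit// mul1mx mxtrace_diag.
rewrite -[RHS]/(complex.Re (_%:C)) rmorph_sum; congr complex.Re.
by apply: eq_bigr => i _; rewrite mxE.
Qed.

End Spectral.

(** * The singular values of a sum of matrices *)

Section Main.
Local Open Scope sesquilinear_scope.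
Local Open Scope complex_scope.
Context {R : realType}.

Lemma quadratic_form_sum (I : finType) n p (E : I -> 'M[R[i]]_n)
    (d : I -> 'I_n -> R) (s : 'I_n -> R) (x : 'M[R[i]]_(n, p)) i :
  \sum_k (E k) ^t* *m rdiag (d k) *m E k = rdiag s ->
  \sum_k \sum_j d k j * sqmod ((E k *m x) j i) = \sum_l s l * sqmod (x l i).
Proof.
move=> Es; apply: complexI; rewrite -gram_rdiag -Es.
rewrite mulmx_sumr mulmx_suml summxE rmorph_sum; apply: eq_bigr => k _ /=.
by rewrite -gram_rdiag adjM !mulmxA.
Qed.

(** If positive matrices E_k^* diag(d_k) E_k sum to diag(s), then their
eigenvalues, taken together, are the image of s under a doubly substochastic
matrix; in particular the l_p norm of all the d_k(j) is at most that of s, which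
is McCarthy's inequality. The matrix is
q((k, j), l) = d_k(j) |E_k(j, l)|^2 / s_l, where indices l with s_l = 0
contribute 0. Its column sums are diagonal entries of diag(s) divided by s_l.
For the row (k, j), let e be row j of E_k and u = \sum_l |e_l|^2 / s_l; the
vector x with entries conj(e_l) / s_l satisfies <x, diag(s) x> = u, while the
term (k, j) of this quadratic form is d_k(j) u^2, so that d_k(j) u <= 1. *)
Lemma pinching (I : finType) n (E : I -> 'M[R[i]]_n) (d : I -> 'I_n -> R)
    (s : 'I_n -> R) :
  (forall k, E k \is unitarymx) -> (forall k j, 0 <= d k j) ->
  \sum_k (E k) ^t* *m rdiag (d k) *m E k = rdiag s ->
  exists q : I * 'I_n -> 'I_n -> R,
  [/\ forall t l, 0 <= q t l, forall t, \sum_l q t l <= 1,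
      forall l, \sum_t q t l <= 1 &
      forall t, d t.1 t.2 = \sum_l q t l * s l].
Proof.
move=> EU d0 Es.
have sE l : \sum_t d t.1 t.2 * sqmod (E t.1 t.2 l) = s l.
  have := quadratic_form_sum 1%:M l Es.
  rewrite [RHS](bigD1 l)//= [X in _ + X]big1 => [|i il]; last first.
    by rewrite mxE (negbTE il) (sqmod_real 0) expr0n mulr0.
  rewrite mxE eqxx (sqmod_real 1) expr1n mulr1 addr0 => <-.
  by rewrite pair_big /=; apply: eq_bigr => t _; rewrite mulmx1.
have t0 t l : 0 <= d t.1 t.2 * sqmod (E t.1 t.2 l).
  by rewrite mulr_ge0 ?sqmod_ge0.
have s0 l : 0 <= s l by rewrite -sE; apply: sumr_ge0.
have q0 t l : 0 <= d t.1 t.2 * sqmod (E t.1 t.2 l) / s l.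
  by rewrite divr_ge0.
exists (fun t l => d t.1 t.2 * sqmod (E t.1 t.2 l) / s l); split=> //.
- move=> [k j] /=; pose u := \sum_l sqmod (E k j l) / s l.
  have u0 : 0 <= u by apply: sumr_ge0 => l _; rewrite divr_ge0 ?sqmod_ge0.
  pose x : 'cV[R[i]]_n := \col_l (Num.conj (E k j l) * (s l)^-1%:C).
  have Ex : (E k *m x) j 0 = u%:C.
    rewrite mxE rmorph_sum; apply: eq_bigr => l _.
    by rewrite mxE mulrA -sqmodE -rmorphM.
  have xs : \sum_l s l * sqmod (x l 0) = u.
    apply: eq_bigr => l _; rewrite mxE sqmodM sqmodC sqmod_real.
    have [->|sl] := eqVneq (s l) 0; first by rewrite invr0 mul0r mulr0.
    by field.
  have : d k j * u ^+ 2 <= u.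
    rewrite -[leRHS]xs -(quadratic_form_sum x 0 Es).
    rewrite (bigD1 k)//= (bigD1 j)//= Ex sqmod_real -addrA lerDl.
    by rewrite addr_ge0// !sumr_ge0// => *; rewrite ?sumr_ge0// => *;
      rewrite mulr_ge0 ?sqmod_ge0.
  have -> : \sum_l d k j * sqmod (E k j l) / s l = d k j * u.
    by rewrite mulr_sumr; apply: eq_bigr => l _; rewrite mulrA.
  move: u0; rewrite le_eqVlt => /orP[/eqP <- _|u0]; first by rewrite mulr0.
  by rewrite expr2 mulrA -[leRHS]mul1r ler_pM2r.
- move=> l; rewrite -mulr_suml sE.
  by have [->|sl] := eqVneq (s l) 0; rewrite ?mul0r// divff.
- move=> [k j] /=.
  have EE : \sum_l sqmod (E k j l) = 1.
    apply: complexI; rewrite rmorph_sum rmorph1 /=.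
    have := unitarymxP (EU k) => /matrixP/(_ j j); rewrite !mxE eqxx mulr1n => <-.
    by apply: eq_bigr => l _; rewrite sqmodE !mxE.
  rewrite -[LHS]mulr1 -EE mulr_sumr; apply: eq_bigr => l _.
  have [sl|sl] := eqVneq (s l) 0; last by rewrite divfK.
  (* When s l = 0, all the nonnegative terms that sum to s l vanish. *)
  rewrite sl mulr0; move: (sE l); rewrite sl => /eqP.
  rewrite psumr_eq0// => /allP/(_ (k, j) (mem_index_enum _)) /= /eqP.
  by [].
Qed.

(** The linear-algebraic core of the theorem, in which p does not appear. The
matrix G consists of the squared overlaps between eigenvectors of
S = \sum_k |A_k| and right singular vectors of X = \sum_k A_k. The matrix H
composes the substochastic matrix of [pinching] with the squared overlaps between
the left singular vectors of X and those of the A_k. *)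
Lemma singular_value_sum_bound (m n : nat) (A : 'I_m -> 'M[R[i]]_n) :
  exists (G H : 'I_n -> 'I_n -> R),
  let s := singular_value (\sum_k absmx (A k)) in
  [/\ (forall i l, 0 <= G i l) /\ (forall i l, 0 <= H i l),
      (forall i, \sum_l G i l <= 1) /\ (forall l, \sum_i G i l <= 1),
      (forall i, \sum_l H i l <= (minn m n)%:R) /\ (forall l, \sum_i H i l <= 1) &
      forall i, singular_value (\sum_k A k) i ^+ 2 <=
        (\sum_l G i l * s l) * (\sum_l H i l * s l)].
Proof.
have [Y /choice[P AP]] := choice (fun k => svd (A k)).
have YP k : partial_isometry (Y k) by have [] := AP k.
have PU k : P k \is unitarymx by have [] := AP k.
pose X := \sum_k A k; pose S := \sum_k absmx (A k).
have [W [V [WP VU WD XE _]]] := svd X.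
have [_ [F [_ FU _ _]]] := svd S.
rewrite absmx_id => [SE|]; last by apply: psd_sum => k; exact: psd_absmx.
pose d k := singular_value (A k); set s := singular_value S in SE.
have d0 k j : 0 <= d k j by exact: singular_value_ge0.
have FK := unitarymxP FU; have FK' : F^t* *m F = 1%:M by exact: mulmx1C.
have ES : \sum_k (P k *m F^t*)^t* *m rdiag (d k) *m (P k *m F^t*) = rdiag s.
  transitivity (F *m S *m F^t*); last by rewrite SE; exact: unitary_conj_cancel.
  rewrite mulmx_sumr mulmx_suml; apply: eq_bigr => k _.
  by have [_ _ _ _ ->] := AP k; rewrite adjM trmxCK !mulmxA.
have EU k : P k *m F^t* \is unitarymx by rewrite mul_unitarymx ?trmxC_unitary.
have [q [q0 qr qc dE]] := pinching EU d0 ES.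
pose B k := P k *m V^t*; pose C k := W^t* *m Y k.
exists (fun i l => sqmod ((F *m V^t*) l i)).
exists (fun i l => \sum_t sqmod (C t.1 i t.2) * q t l) => /=.
have Cq0 i l t : 0 <= sqmod (C t.1 i t.2) * q t l by rewrite mulr_ge0 ?sqmod_ge0.
have FP := partial_isometry_adj (unitary_partial_isometry FU).
have VP := partial_isometry_adj (unitary_partial_isometry VU).
have Hc l : \sum_i \sum_t sqmod (C t.1 i t.2) * q t l <= 1.
  rewrite exchange_big /=; apply: le_trans (qc l); apply: ler_sum => t _.
  rewrite -mulr_suml -[leRHS]mul1r ler_wpM2r//.
  exact: overlap_col_le1.
split.
- by split=> i l; rewrite ?sqmod_ge0// sumr_ge0.
- split=> [i|l]; rewrite -{1}[F]trmxCK.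
    exact: overlap_col_le1.
  exact: overlap_row_le1.
- split=> // i; rewrite /minn; case: ifP => _.
    (* Summing over l first, each of the m blocks has row sums at most 1. *)
    rewrite exchange_big /=.
    apply: (@le_trans _ _ (\sum_(t : 'I_m * 'I_n) sqmod (C t.1 i t.2))).
      apply: ler_sum => t _; rewrite -mulr_sumr -[leRHS]mulr1.
      by rewrite ler_wpM2l ?sqmod_ge0.
    rewrite -(pair_big predT predT (fun k j => sqmod (C k i j))) /=.
    rewrite -[m in leRHS]card_ord -sumr_const; apply: ler_sum => k _.
    exact: overlap_row_le1.
  (* Each of the n entries of the row is at most its column sum. *)
  rewrite -[n in leRHS]card_ord -sumr_const; apply: ler_sum => l _.
  apply: le_trans (Hc l); rewrite [leRHS](bigD1 i)//= lerDl.
  by rewrite sumr_ge0// => *; rewrite sumr_ge0.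
move=> i; rewrite -/X -/S -/s.
have -> : \sum_l sqmod ((F *m V^t*) l i) * s l
    = \sum_(t : 'I_m * 'I_n) d t.1 t.2 * sqmod (B t.1 t.2 i).
  rewrite -(pair_big predT predT (fun k j => d k j * sqmod (B k j i))) /=.
  transitivity (\sum_l s l * sqmod ((F *m V^t*) l i)).
    by apply: eq_bigr => l _; rewrite mulrC.
  rewrite -(quadratic_form_sum _ _ ES); apply: eq_bigr => k _.
  by rewrite !mulmxA -(mulmxA (P k)) FK' mulmx1.
have -> : \sum_l (\sum_t sqmod (C t.1 i t.2) * q t l) * s l
    = \sum_(t : 'I_m * 'I_n) d t.1 t.2 * sqmod (C t.1 i t.2).
  under eq_bigr do rewrite mulr_suml.
  rewrite exchange_big; apply: eq_bigr => t _ /=.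
  by rewrite dE mulr_suml; apply: eq_bigr => l _; ring.
pose w (t : 'I_m * 'I_n) := d t.1 t.2 *
  (Num.sqrt (sqmod (C t.1 i t.2)) * Num.sqrt (sqmod (B t.1 t.2 i))).
have w0 t : 0 <= w t by rewrite !mulr_ge0 ?sqrtr_ge0.
apply: (@le_trans _ _ ((\sum_t w t) ^+ 2)); last first.
  apply: cauchy_schwarz_sum => // t; rewrite ?mulr_ge0 ?sqmod_ge0//.
  rewrite /w !exprMn !sqr_sqrtr ?sqmod_ge0// expr2.
  by rewrite le_eqVlt; apply/orP; left; apply/eqP; ring.
rewrite ler_sqr ?nnegrE ?singular_value_ge0 ?sumr_ge0// -lecR.
have sE : (singular_value X i)%:C = \sum_(t : 'I_m * 'I_n)
    C t.1 i t.2 * (d t.1 t.2)%:C * B t.1 t.2 i.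
  rewrite -(pair_big predT predT (fun k j => C k i j * (d k j)%:C * B k j i)) /=.
  rewrite -rdiagii -WD.
  transitivity ((W^t* *m X *m V^t*) i i).
    by rewrite [in RHS]XE !mulmxA -(mulmxA _ V) (unitarymxP VU) mulmx1.
  rewrite mulmx_sumr mulmx_suml summxE; apply: eq_bigr => k _.
  have [_ _ _ -> _] := AP k; rewrite -/(d k).
  have -> : W^t* *m (Y k *m rdiag (d k) *m P k) *m V^t* =
    C k *m rdiag (d k) *m B k by rewrite !mulmxA.
  by rewrite mxE; apply: eq_bigr => j _; rewrite mul_rdiagE.
rewrite -[leLHS]ger0_norm ?ler0c ?singular_value_ge0// sE.
apply: le_trans (ler_norm_sum _ _ _) _.
rewrite rmorph_sum; apply: ler_sum => t _.
have dC : `|(d t.1 t.2)%:C| = (d t.1 t.2)%:C by rewrite ger0_norm// ler0c.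
rewrite !normrM dC !normc_def -!rmorphM lecR /w -!/(sqmod _).
by rewrite le_eqVlt; apply/orP; left; apply/eqP; ring.
Qed.

End Main.

(** * The norm inequality *)

(* In the exponent, 2 * +oo = +oo and (+oo)^-1 = 0 in \bar R. *)
Theorem proposition6p3 (R : realType) (m n : nat) (hm : (2 <= m)%N)
    (hn : (2 <= n)%N) (p : \bar R) (hp : (1 <= p)%E)
    (A : 'I_m -> 'M[R[i]]_n) :
  schatten_norm p (\sum_(k < m) A k) <=
    (minn m n)%:R `^ (2^-1 - fine (2%:E * p)^-1%E) *
    schatten_norm p (\sum_(k < m) absmx (A k)).
Proof.
have [G [H /=]] := singular_value_sum_bound A.
rewrite !schatten_normE; set x := singular_value _; set s := singular_value _.
move=> [[G0 H0] [Gr Gc] [Hr Hc] xGH].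
set d : R := (minn m n)%:R in Hr *.
have d0 : 0 < d by rewrite ltr0n leq_min (ltnW hm) (ltnW hn).
have s0 l : 0 <= s l by exact: singular_value_ge0.
pose a i := \sum_l G i l * s l; pose b i := \sum_l H i l * s l.
have a0 i : 0 <= a i by apply: sumr_ge0 => l _; rewrite mulr_ge0.
have b0 i : 0 <= b i by apply: sumr_ge0 => l _; rewrite mulr_ge0.
have aN := lp_schur hp ltr01 G0 s0 Gr Gc (fun i => erefl (a i)).
have bN := lp_schur hp d0 H0 s0 Hr Hc (fun i => erefl (b i)).
rewrite powR1 mul1r in aN.
have x0 i : 0 <= x i by exact: singular_value_ge0.
have xab i : x i ^+ 2 <= a i * b i := xGH i.
have xN := lp_geomean hp x0 a0 b0 xab.
set c := 1 - fine p^-1%E in bN.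
have -> : 2^-1 - fine (2%:E * p)^-1%E = c / 2.
  rewrite /c; case: (p) hp => [r| |] //; rewrite ?lee_fin => r1.
    have r0 : r != 0 by rewrite gt_eqF// (lt_le_trans _ r1).
    rewrite -EFinM !inver mulf_eq0 pnatr_eq0 (negbTE r0) /=; field; exact: r0.
  by rewrite gt0_muley ?lte_fin// invey /= !subr0 mul1r.
rewrite -ler_sqr ?nnegrE ?mulr_ge0 ?lp_ge0 ?powR_ge0//.
apply: le_trans xN _; apply: le_trans (ler_pM _ _ aN bN) _; rewrite ?lp_ge0//.
have -> : d `^ c = (d `^ (c / 2)) ^+ 2.
  by rewrite -powR_mulrn ?powR_ge0// -powRrM divfK ?pnatr_eq0.
by rewrite le_eqVlt; apply/orP; left; apply/eqP; ring.
Qed.
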